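(* The partially ordered set $(\mathcal{S}_{m,n},\le_B)$ is a distributive lattice, and it is the Dedekind–MacNeille completion of $(\mathcal{S}^+_{m,n},\le_B)$.
   Context: A sign-restricted matrix (SRM) is an $m\times n$ matrix $A=[a_{ij}]$ with entries in $\{0,1,-1\}$ such that every partial column sum $\sum_{k=1}^{i} a_{kj}$ equals $0$ or $1$, and every partial row sum $\sum_{l=1}^{j} a_{il}$ is nonnegative. $\mathcal{S}_{m,n}$ is the set of $m\times n$ SRMs and $\mathcal{S}^+_{m,n}$ the subset of those with no entry $-1$. For an $m\times n$ matrix $A$, its sum-matrix is $\Sigma(A)=[\sigma_{ij}(A)]$ with $\sigma_{ij}(A)=\sum_{p\le i,\,q\le j}a_{pq}$. The Bruhat order is defined by $A_1\le_B A_2$ if and only if $\Sigma(A_1)\ge\Sigma(A_2)$ entrywise. *)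

(* Defs.v *)
From HB Require Import structures.
From mathcomp Require Import all_boot all_order all_algebra.
From mathcomp Require Import boolp classical_sets functions.

Set Implicit Arguments.
Unset Strict Implicit.
Unset Printing Implicit Defensive.

Import Order.TTheory GRing.Theory Num.Theory.
Local Open Scope ring_scope.

Definition col_partial_sum m n (A : 'M[int]_(m, n)) (i : 'I_m) (j : 'I_n) : int :=
  \sum_(k < m | (k <= i)%N) A k j.

Definition row_partial_sum m n (A : 'M[int]_(m, n)) (i : 'I_m) (j : 'I_n) : int :=
  \sum_(l < n | (l <= j)%N) A i l.

Definition is_srm m n (A : 'M[int]_(m, n)) : bool :=
  [forall i, forall j,
    [&& A i j \in [:: 0; 1; -1],
        col_partial_sum A i j \in [:: 0; 1]
      & 0 <= row_partial_sum A i j]].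

Record srm (m n : nat) := SRM {
  srm_mx :> 'M[int]_(m, n);
  _ : is_srm srm_mx
}.

HB.instance Definition _ m n := [isSub for @srm_mx m n].
HB.instance Definition _ m n := [Choice of srm m n by <:].

Definition sum_matrix m n (A : 'M[int]_(m, n)) : 'M[int]_(m, n) :=
  \matrix_(i, j) \sum_(p < m | (p <= i)%N) \sum_(q < n | (q <= j)%N) A p q.

(* The order is reversed on sum-matrices: a larger matrix has smaller sums. *)
Definition bruhat_le m n (A1 A2 : 'M[int]_(m, n)) : bool :=
  [forall i, forall j, sum_matrix A2 i j <= sum_matrix A1 i j].

Lemma partial_sums_inj n (f g : 'I_n -> int) :
  (forall j : 'I_n, \sum_(q < n | (q <= j)%N) f q
                    = \sum_(q < n | (q <= j)%N) g q) ->
  f =1 g.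
Proof.
move=> eq_fg j; have [k] := ubnP (j : nat); elim: k j => // k IHk j le_jk.
have := eq_fg j; rewrite (bigD1 j) //= [RHS](bigD1 j) //=.
rewrite [X in _ + X = _](eq_bigr g); first by move/addIr.
move=> q /andP[le_qj neq_qj]; apply: IHk.
by rewrite -ltnS (leq_trans _ le_jk) // !ltnS ltn_neqAle neq_qj.
Qed.

Lemma sum_matrix_inj m n : injective (@sum_matrix m n).
Proof.
move=> A B /matrixP eqAB; apply/matrixP => i.
apply: partial_sums_inj => j; move: i; apply: partial_sums_inj => i.
by have := eqAB i j; rewrite !mxE.
Qed.

Lemma bruhat_le_refl m n : reflexive (@bruhat_le m n).
Proof. by move=> A; apply/forallP => i; apply/forallP => j. Qed.

Lemma bruhat_le_anti m n : antisymmetric (@bruhat_le m n).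
Proof.
move=> A B /andP[/forallP leAB /forallP leBA].
apply: sum_matrix_inj; apply/matrixP => i j; apply: le_anti.
by rewrite (forallP (leBA i) j) (forallP (leAB i) j).
Qed.

Lemma bruhat_le_trans m n : transitive (@bruhat_le m n).
Proof.
move=> B A C /forallP leAB /forallP leBC.
apply/forallP => i; apply/forallP => j.
exact: le_trans (forallP (leBC i) j) (forallP (leAB i) j).
Qed.

Fact bruhat_display : Order.disp_t. Proof. by []. Qed.

Section SrmOrder.
Variables m n : nat.

Definition srm_le (A B : srm m n) : bool := bruhat_le A B.

Lemma srm_le_refl : reflexive srm_le.
Proof. by move=> A; apply: bruhat_le_refl. Qed.

Lemma srm_le_anti : antisymmetric srm_le.
Proof. by move=> A B leAB; apply: val_inj; apply: bruhat_le_anti. Qed.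

Lemma srm_le_trans : transitive srm_le.
Proof. by move=> B A C; apply: bruhat_le_trans. Qed.

HB.instance Definition _ :=
  Order.Le_isPOrder.Build bruhat_display (srm m n)
    srm_le_refl srm_le_anti srm_le_trans.
End SrmOrder.

Record srm_plus (m n : nat) := SRMPlus {
  srm_plus_srm :> srm m n;
  _ : [forall i, forall j, srm_plus_srm i j != -1]
}.

HB.instance Definition _ m n := [isSub for @srm_plus_srm m n].
HB.instance Definition _ m n := [Choice of srm_plus m n by <:].
HB.instance Definition _ m n :=
  [SubChoice_isSubPOrder of srm_plus m n by <: with bruhat_display].

(* The equality is between order structures, so the order of the lattice [L]
   is the given order on [T]. *)
Definition is_distr_lattice d (T : porderType d) : Prop :=
  exists L : distrLatticeType d, L = T :> porderType d.

Local Open Scope classical_set_scope.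

Definition dm_cuts d (P : porderType d) : set (set P) :=
  [set X | lbound (ubound X) = X].

(* [L] is order-isomorphic to the inclusion-ordered set of cuts of [P], the
   map [incl] corresponding to the canonical embedding of [P] by principal
   ideals. *)
Definition is_dedekind_macneille_completion d d' (P : porderType d)
    (L : porderType d') (incl : P -> L) : Prop :=
  exists f : L -> set P,
    [/\ set_bij [set: L] (@dm_cuts d P) f,
        forall x y : L, f x `<=` f y <-> (x <= y)%O
      & forall p : P, f (incl p) = [set q | (q <= p)%O]].

(* Main.v *)
Require Import Defs.
From mathcomp Require Import all_boot all_order all_algebra.
From mathcomp Require Import boolp classical_sets zify.
From HB Require Import structures.

Set Implicit Arguments.
Unset Strict Implicit.
Unset Printing Implicit Defensive.

Import Order.TTheory GRing.Theory Num.Theory.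
Local Open Scope ring_scope.

(* An SRM is determined by its corner sums s(a, b), the sums of its top left
   a x b blocks. A function s that vanishes on the axes arises in this way if
   and only if its horizontal steps are 0 or 1 and its vertical steps are
   nonnegative. These conditions are stable under pointwise minima and maxima,
   so SRMs form a complete distributive lattice. For the completion it remains
   to see that every SRM is both a join and a meet of SRMs without entry -1.
   Given an SRM with corner sums s and a row i >= 1, the functions
     (0 for a < i, and s(i, b) for a >= i)   and
     (0 for a = 0, s(i, b) for 1 <= a <= i, and b for a > i)
   are corner sums of such matrices, because their horizontal steps increase
   with a. They bound s from below and from above, and agree with s in
   row i. *)

(** * Corner sums indexed by all natural numbers *)

Definition entry m n (A : 'M[int]_(m, n)) (a b : nat) : int :=
  match insub a, insub b with Some i, Some j => A i j | _, _ => 0 end.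

Lemma entryE m n (A : 'M[int]_(m, n)) (i : 'I_m) (j : 'I_n) :
  entry A i j = A i j.
Proof. by rewrite /entry !valK. Qed.

Lemma entry_row0 m n (A : 'M[int]_(m, n)) (a b : nat) :
  (m <= a)%N -> entry A a b = 0.
Proof. by rewrite /entry leqNgt => lt_am; rewrite insubN. Qed.

Lemma entry_col0 m n (A : 'M[int]_(m, n)) (a b : nat) :
  (n <= b)%N -> entry A a b = 0.
Proof.
by rewrite /entry leqNgt => lt_bn; rewrite [insub b]insubN //; case: insub.
Qed.

Definition corner_sum m n (A : 'M[int]_(m, n)) (a b : nat) : int :=
  \sum_(p < a) \sum_(q < b) entry A p q.

Lemma corner_sumSl m n (A : 'M[int]_(m, n)) (a b : nat) :
  corner_sum A a.+1 b = corner_sum A a b + \sum_(q < b) entry A a q.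
Proof. by rewrite /corner_sum big_ord_recr. Qed.

Lemma corner_sumSr m n (A : 'M[int]_(m, n)) (a b : nat) :
  corner_sum A a b.+1 = corner_sum A a b + \sum_(p < a) entry A p b.
Proof.
by rewrite /corner_sum -big_split; apply: eq_bigr => p _; rewrite big_ord_recr.
Qed.

Lemma sum_ord_leq m (f : nat -> int) (i : 'I_m) :
  \sum_(k < m | (k <= i)%N) f k = \sum_(k < i.+1) f k.
Proof. by rewrite (big_ord_widen m f). Qed.

Lemma col_partial_sumE m n (A : 'M[int]_(m, n)) (i : 'I_m) (j : 'I_n) :
  col_partial_sum A i j = \sum_(k < i.+1) entry A k j.
Proof.
rewrite -(sum_ord_leq (fun k => entry A k j)).
by apply: eq_bigr => k _; rewrite entryE.
Qed.

Lemma row_partial_sumE m n (A : 'M[int]_(m, n)) (i : 'I_m) (j : 'I_n) :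
  row_partial_sum A i j = \sum_(k < j.+1) entry A i k.
Proof.
rewrite -(sum_ord_leq (fun k => entry A i k)).
by apply: eq_bigr => k _; rewrite entryE.
Qed.

Lemma sum_matrixE m n (A : 'M[int]_(m, n)) (i : 'I_m) (j : 'I_n) :
  sum_matrix A i j = corner_sum A i.+1 j.+1.
Proof.
rewrite mxE /corner_sum -(sum_ord_leq (fun p => \sum_(q < j.+1) entry A p q)).
apply: eq_bigr => p _; rewrite -(sum_ord_leq (fun q => entry A p q)).
by apply: eq_bigr => q _; rewrite entryE.
Qed.

(** For [corner_sum], horizontal steps are partial column sums and vertical steps are partial row
    sums. The conditions range over all [a] and [b], as [entry] extends the matrix by zeros. *)
Definition corner_fun (s : nat -> nat -> int) : Prop :=
  [/\ forall b, s 0%N b = 0, forall a, s a 0%N = 0,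
      forall a b, s a b <= s a b.+1 <= s a b + 1
    & forall a b, s a b <= s a.+1 b].

Lemma is_srm_corner_fun m n (A : 'M[int]_(m, n)) :
  is_srm A -> corner_fun (corner_sum A).
Proof.
move=> srmA; have srmP i j := forallP (forallP srmA i) j.
split.
- by move=> b; rewrite /corner_sum big_ord0.
- by move=> a; rewrite /corner_sum big1 // => p _; rewrite big_ord0.
- move=> a b; rewrite corner_sumSr.
  suff: 0 <= \sum_(p < a) entry A p b <= 1 by lia.
  elim: a => [|a IHa]; first by rewrite big_ord0.
  (* Below the last row the added entry is zero, so the bounds carry over. *)
  have [le_ma|lt_am] := leqP m a.
    by rewrite big_ord_recr /= entry_row0 // addr0.
  have [le_nb|lt_bn] := leqP n b.
    by rewrite big1 // => p _; rewrite entry_col0.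
  have /and3P[_ + _] := srmP (Ordinal lt_am) (Ordinal lt_bn).
  by rewrite col_partial_sumE /= !inE => /orP[]/eqP->.
- move=> a b; rewrite corner_sumSl lerDl.
  elim: b => [|b IHb]; first by rewrite big_ord0.
  have [le_nb|lt_bn] := leqP n b.
    by rewrite big_ord_recr /= entry_col0 // addr0.
  have [le_ma|lt_am] := leqP m a.
    by rewrite big1 // => p _; rewrite entry_row0.
  have /and3P[_ _] := srmP (Ordinal lt_am) (Ordinal lt_bn).
  by rewrite row_partial_sumE.
Qed.

Definition mx_of_corner m n (s : nat -> nat -> int) : 'M[int]_(m, n) :=
  \matrix_(i, j) (s i.+1 j.+1 - s i j.+1 - (s i.+1 j - s i j)).

Lemma entry_mx_of_corner m n s (a b : nat) : (a < m)%N -> (b < n)%N ->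
  entry (mx_of_corner m n s) a b
  = s a.+1 b.+1 - s a b.+1 - (s a.+1 b - s a b).
Proof.
by move=> lt_am lt_bn; rewrite (entryE _ (Ordinal lt_am) (Ordinal lt_bn)) mxE.
Qed.

Lemma corner_sum_mx_of_corner m n s (a b : nat) :
  corner_fun s -> (a <= m)%N -> (b <= n)%N ->
  corner_sum (mx_of_corner m n s) a b = s a b.
Proof.
move=> [s0b sa0 _ _]; elim: a => [|a IHa] le_am le_bn.
  by rewrite /corner_sum big_ord0 s0b.
rewrite corner_sumSl IHa //; last exact: ltnW.
elim: b le_bn {IHa} => [|b IHb] lt_bn; first by rewrite big_ord0 !sa0.
rewrite big_ord_recr /= entry_mx_of_corner //.
by move: (\sum_(q < b) _) (IHb (ltnW lt_bn)) => S; lia.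
Qed.

(** Each entry is a difference of two horizontal steps, both 0 or 1; the partial sums telescope to
    single steps of [s]. *)
Lemma mx_of_corner_is_srm m n s : corner_fun s -> is_srm (mx_of_corner m n s).
Proof.
move=> cs; have [s0b sa0 sh sv] := cs.
apply/forallP => i; apply/forallP => j; apply/and3P; split.
- by rewrite mxE !inE; have := sh i j; have := sh i.+1 j; lia.
- have := corner_sumSr (mx_of_corner m n s) i.+1 j.
  rewrite col_partial_sumE !corner_sum_mx_of_corner ?(ltnW (ltn_ord j)) //.
  by rewrite !inE; have := sh i.+1 j; lia.
- have := corner_sumSl (mx_of_corner m n s) i j.+1.
  rewrite row_partial_sumE !corner_sum_mx_of_corner ?(ltnW (ltn_ord i)) //.
  by have := sv i j.+1; lia.
Qed.

Definition srm_of_corner m n s (cs : corner_fun s) : srm m n :=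
  SRM (mx_of_corner_is_srm m n cs).

Lemma srm_of_cornerE m n s (cs : corner_fun s) (a b : nat) :
  (a <= m)%N -> (b <= n)%N -> corner_sum (srm_of_corner m n cs) a b = s a b.
Proof. exact: corner_sum_mx_of_corner. Qed.

Lemma srm_corner_fun m n (A : srm m n) : corner_fun (corner_sum A).
Proof. exact/is_srm_corner_fun/(valP A). Qed.

Lemma srm_leP m n (A B : srm m n) :
  reflect (forall a b, (a <= m)%N -> (b <= n)%N ->
             corner_sum B a b <= corner_sum A a b)
          (A <= B)%O.
Proof.
have [A0b Aa0 _ _] := srm_corner_fun A; have [B0b Ba0 _ _] := srm_corner_fun B.
apply: (iffP idP) => [leAB [|a] [|b]|leAB]; rewrite ?A0b ?Aa0 ?B0b ?Ba0 //.
  move=> lt_am lt_bn.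
  have := forallP (forallP leAB (Ordinal lt_am)) (Ordinal lt_bn).
  by rewrite !sum_matrixE.
by apply/forallP => i; apply/forallP => j; rewrite !sum_matrixE leAB.
Qed.

(** * Bounds on corner functions and the distributive lattice *)

Lemma corner_fun_ge0 s a b : corner_fun s -> 0 <= s a b.
Proof. by case=> s0b _ _ sv; elim: a => [|a /le_trans->]; rewrite ?s0b. Qed.

Lemma corner_fun_le_col s a b : corner_fun s -> s a b <= b%:Z.
Proof.
by case=> _ sa0 sh _; elim: b => [|b IHb]; rewrite ?sa0 //; have := sh a b; lia.
Qed.

Lemma corner_fun_mono s a a' b : corner_fun s -> (a <= a')%N -> s a b <= s a' b.
Proof.
by case=> _ _ _ sv /subnK<-; elim: (a' - a)%N => //= k /le_trans->.
Qed.

(** Each condition compares values of the function, possibly shifted by 1; minima are monotone and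
    commute with this shift. *)
Lemma corner_fun_min s t :
  corner_fun s -> corner_fun t ->
  corner_fun (fun a b => Num.min (s a b) (t a b)).
Proof.
move=> [s0b sa0 sh sv] [t0b ta0 th tv]; split=> [b|a|a b|a b].
- by rewrite s0b t0b.
- by rewrite sa0 ta0.
- by have := sh a b; have := th a b; lia.
- by have := sv a b; have := tv a b; lia.
Qed.

Lemma corner_fun_max s t :
  corner_fun s -> corner_fun t ->
  corner_fun (fun a b => Num.max (s a b) (t a b)).
Proof.
move=> [s0b sa0 sh sv] [t0b ta0 th tv]; split=> [b|a|a b|a b].
- by rewrite s0b t0b.
- by rewrite sa0 ta0.
- by have := sh a b; have := th a b; lia.
- by have := sv a b; have := tv a b; lia.
Qed.

Section SrmLattice.
Variables m n : nat.
Implicit Types A B C : srm m n.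

(* The Bruhat order reverses the order of the corner sums. *)
Definition srm_meet A B : srm m n :=
  srm_of_corner m n (corner_fun_max (srm_corner_fun A) (srm_corner_fun B)).

Definition srm_join A B : srm m n :=
  srm_of_corner m n (corner_fun_min (srm_corner_fun A) (srm_corner_fun B)).

Lemma srm_le_meet A B C :
  (A <= srm_meet B C)%O = (A <= B)%O && (A <= C)%O.
Proof.
apply/srm_leP/andP => [leA|[/srm_leP leB /srm_leP leC] a b le_am le_bn].
  by split; apply/srm_leP => a b le_am le_bn; have := leA a b le_am le_bn;
     rewrite srm_of_cornerE // ge_max => /andP[].
by rewrite srm_of_cornerE // ge_max leB ?leC.
Qed.

Lemma srm_join_le A B C :
  (srm_join A B <= C)%O = (A <= C)%O && (B <= C)%O.
Proof.
apply/srm_leP/andP => [leC|[/srm_leP leA /srm_leP leB] a b le_am le_bn].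
  by split; apply/srm_leP => a b le_am le_bn; have := leC a b le_am le_bn;
     rewrite srm_of_cornerE // le_min => /andP[].
by rewrite srm_of_cornerE // le_min leA ?leB.
Qed.

Lemma srm_meet_joinl : left_distributive srm_meet srm_join.
Proof.
move=> A B C; apply/le_anti/andP; split; apply/srm_leP => a b le_am le_bn;
  by rewrite !srm_of_cornerE //; lia.
Qed.

HB.instance Definition _ :=
  Order.POrder_MeetJoin_isLattice.Build bruhat_display (srm m n)
    srm_le_meet srm_join_le.

HB.instance Definition _ :=
  Order.Lattice_Meet_isDistrLattice.Build bruhat_display (srm m n)
    srm_meet_joinl.
End SrmLattice.

Lemma srm_is_distr_lattice m n : is_distr_lattice (srm m n).
Proof. by exists (srm m n : distrLatticeType bruhat_display). Qed.

(** The largest corner function, hence the least SRM: ones in the first row, zeros below. *)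
Lemma corner_fun_bot : corner_fun (fun a b => if a is 0%N then 0 else b%:Z).
Proof. by split=> [b|[|a]|[|a] b|[|a] b] //=; lia. Qed.

(** * Suprema of arbitrary sets *)

Local Open Scope classical_set_scope.

Lemma exists_min_nonneg (T : Type) (X : set T) (f : T -> int) :
  X !=set0 -> (forall x, 0 <= f x) ->
  exists x, X x /\ forall y, X y -> f x <= f y.
Proof.
move=> [x0 Xx0] f_ge0.
have exP : exists k, `[< exists2 x, X x & f x = k%:Z >].
  by exists `|f x0|%N; apply/asboolP; exists x0; rewrite // gez0_abs.
have [k /asboolP[x Xx fx] kmin] := ex_minnP exP.
exists x; split=> // y Xy; have fy : f y = `|f y|%N by rewrite gez0_abs.
by rewrite fx fy lez_nat; apply/kmin/asboolP; exists y.
Qed.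

(** The corner sums of the supremum are the pointwise infima, each attained by an SRM [M (a, b)]
    that depends on the position. *)
Lemma srm_has_sup m n (X : set (srm m n)) :
  exists x : srm m n,
    forall y : srm m n, (x <= y)%O <-> forall A, X A -> (A <= y)%O.
Proof.
(* Adding the least SRM keeps the pointwise infimum defined when X is empty. *)
pose bot := srm_of_corner m n corner_fun_bot.
pose Y := bot |` X.
have Y0 : Y !=set0 by exists bot; left.
have [M MP] := choice (fun ab : nat * nat => exists_min_nonneg Y0
  (fun A : srm m n => corner_fun_ge0 ab.1 ab.2 (srm_corner_fun A))).
pose s a b := corner_sum (M (a, b)) a b.
have YM a b : Y (M (a, b)) by have [] := MP (a, b).
have s_le A a b : Y A -> s a b <= corner_sum A a b.
  by have [_] := MP (a, b); exact.
have cs : corner_fun s.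
  split=> [b|a|a b|a b].
  - by rewrite /s; have [->] := srm_corner_fun (M (0%N, b)).
  - by rewrite /s; have [_ ->] := srm_corner_fun (M (a, 0%N)).
  (* The minimizers at the two positions may differ; comparing each with [s] at the other position
     bounds the step of [s]. *)
  - have [_ _ sh _] := srm_corner_fun (M (a, b)).
    have [_ _ sh' _] := srm_corner_fun (M (a, b.+1)).
    have := s_le _ a b (YM a b.+1); have := s_le _ a b.+1 (YM a b).
    by rewrite /s; have := sh a b; have := sh' a b; lia.
  - have [_ _ _ sv] := srm_corner_fun (M (a.+1, b)).
    exact: le_trans (s_le _ a b (YM a.+1 b)) (sv a b).
exists (srm_of_corner m n cs) => y; split=> [/srm_leP le_y A XA|leXy].
  apply/srm_leP => a b le_am le_bn; apply: le_trans (le_y a b le_am le_bn) _.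
  by rewrite srm_of_cornerE //; apply: s_le; right.
apply/srm_leP => a b le_am le_bn; rewrite srm_of_cornerE // /s.
(* The minimizer is [bot] or lies in [X]; [bot] has the largest possible corner sums. *)
have [-> | /leXy/srm_leP] := YM a b; last exact.
have [y0b _ _ _] := srm_corner_fun y.
rewrite srm_of_cornerE //; case: a le_am => [|a] _; first by rewrite y0b.
exact/corner_fun_le_col/srm_corner_fun.
Qed.

(** * Density of the matrices without entry -1, and the completion *)

Lemma srm_of_corner_plus m n s (cs : corner_fun s) :
  (forall a b, s a b.+1 - s a b <= s a.+1 b.+1 - s a.+1 b) ->
  exists p : srm_plus m n, srm_plus_srm p = srm_of_corner m n cs.
Proof.
move=> step_mono.
suff pP : [forall i, forall j, srm_of_corner m n cs i j != -1].
  by exists (SRMPlus pP).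
(* The entry is the increase of the horizontal step of [s] from row [i] to row [i.+1]. *)
apply/forallP => i; apply/forallP => j; rewrite mxE.
by have := step_mono i j; lia.
Qed.

(** One test matrix per row suffices: its corner sums bound those of [x] from above, so it lies
    below [x], and they agree with those of [x] in the chosen row. *)
Lemma srm_plus_join_dense m n (x y : srm m n) :
  (forall p : srm_plus m n, (srm_plus_srm p <= x)%O -> (srm_plus_srm p <= y)%O)
  -> (x <= y)%O.
Proof.
move=> le_xy; apply/srm_leP => -[|i] b le_im le_bn.
  have [-> _ _ _] := srm_corner_fun x.
  by have [-> _ _ _] := srm_corner_fun y.
have cx := srm_corner_fun x; have [x0b xa0 xh xv] := cx.
pose s a b := if a is 0%N then 0
              else if (a <= i.+1)%N then corner_sum x i.+1 b else b%:Z.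
have cs : corner_fun s.
  rewrite /s; split=> [//|[|a]|[|a] c|[|a] c] //=.
  - by rewrite xa0; case: ifP.
  - by case: ifP => _; have := xh i.+1 c; lia.
  - exact: corner_fun_ge0.
  - have := corner_fun_le_col i.+1 c cx.
    by case: ifP; case: ifP; lia.
have [|p pE] := @srm_of_corner_plus m n s cs.
  (* The horizontal steps of [s] are 0 in row 0, those of [x] in row [i.+1] up to that row, and 1
     afterwards. *)
  move=> [|a] c; rewrite /s; have := xh i.+1 c.
    by rewrite ltn0Sn; lia.
  by case: ifP; case: ifP; lia.
have /le_xy/srm_leP/(_ i.+1 b le_im le_bn) : (srm_plus_srm p <= x)%O.
  rewrite pE; apply/srm_leP => -[|a] c le_am le_cn; rewrite srm_of_cornerE //=.
    by rewrite x0b.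
  case: ifP => [le_ai|_]; last exact: corner_fun_le_col.
  exact: corner_fun_mono.
by rewrite pE srm_of_cornerE // /s leqnn.
Qed.

Lemma srm_plus_meet_dense m n (x y : srm m n) :
  (forall p : srm_plus m n, (y <= srm_plus_srm p)%O -> (x <= srm_plus_srm p)%O)
  -> (x <= y)%O.
Proof.
move=> le_xy; apply/srm_leP => i b le_im le_bn.
have cy := srm_corner_fun y; have [y0b ya0 yh yv] := cy.
pose s a b := if (a < i)%N then 0 else corner_sum y i b.
have cs : corner_fun s.
  rewrite /s; split=> [c|a|a c|a c] /=.
  (* For [i = 0], row 0 of [s] is row 0 of the corner sums of [y], which also vanishes. *)
  - by case: i {s le_im} => [|i]; rewrite ?y0b ?if_same.
  - by rewrite ya0; case: ifP.
  - by case: ifP => _ //; have := yh i c; lia.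
  - by have := corner_fun_ge0 i c cy; case: ifP; case: ifP; lia.
have [|p pE] := @srm_of_corner_plus m n s cs.
  by move=> a c; rewrite /s; have := yh i c; case: ifP; case: ifP; lia.
have /le_xy/srm_leP/(_ i b le_im le_bn) : (y <= srm_plus_srm p)%O.
  rewrite pE; apply/srm_leP => a c le_am le_cn; rewrite srm_of_cornerE // /s.
  case: ltnP => [_|le_ia]; first exact: corner_fun_ge0.
  exact: corner_fun_mono.
by rewrite pE srm_of_cornerE // /s ltnn.
Qed.

(** Send [x] to the elements of [P] below it. By join density the upper bounds of this set are the
    elements of [P] above [x]; by meet density their lower bounds are the set itself, which is
    therefore a cut. *)
Lemma dedekind_macneille_of_dense d d' (P : porderType d) (L : porderType d')
    (incl : P -> L) :
  (forall p q, (incl p <= incl q)%O = (p <= q)%O) ->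
  (forall x y, (forall p, (incl p <= x)%O -> (incl p <= y)%O) -> (x <= y)%O) ->
  (forall x y, (forall p, (y <= incl p)%O -> (x <= incl p)%O) -> (x <= y)%O) ->
  (forall X : set L, exists x, forall y,
     (x <= y)%O <-> forall z, X z -> (z <= y)%O) ->
  is_dedekind_macneille_completion incl.
Proof.
move=> inclE jdense mdense sup.
pose f (x : L) : set P := [set p | (incl p <= x)%O].
have fE x y : f x `<=` f y <-> (x <= y)%O.
  by split=> [/jdense//|le_xy p /= /le_trans]; exact.
have lbound_above (U : set P) (x : L) :
    (forall p, U p <-> (x <= incl p)%O) -> lbound U = f x.
  move=> UE; apply/seteqP; split=> q /= qP.
    by apply: mdense => p /UE Up; rewrite inclE; exact: qP.
  by move=> p /UE le_xp; rewrite -inclE; exact: le_trans le_xp.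
exists f; split=> //; last first.
  by move=> p; apply/seteqP; split=> q; rewrite /f /= inclE.
split.
- move=> x _; apply: lbound_above => p; split=> [pP|le_xp q qx].
    by apply: jdense => q qx; rewrite inclE; exact: pP.
  by rewrite -inclE; exact: le_trans le_xp.
- by move=> x y _ _ fxy; apply/le_anti/andP; split; apply/fE; rewrite fxy.
(* A cut comes from the supremum of its image in [L], since the elements of [P] above this supremum
   are the upper bounds of the cut. *)
- move=> X XE; have [x xP] := sup (incl @` X).
  exists x => //; rewrite -[RHS]XE; apply/esym/lbound_above => p.
  split=> [pP|/xP le_p q Xq].
    by apply/xP => _ [q Xq <-]; rewrite inclE; exact: pP.
  by rewrite -inclE; apply: le_p; exists q.
Qed.

Theorem theorem4p2 (m n : nat) :
  is_distr_lattice (srm m n) /\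
  is_dedekind_macneille_completion (@srm_plus_srm m n).
Proof.
split; first exact: srm_is_distr_lattice.
apply: dedekind_macneille_of_dense => //.
- exact: srm_plus_join_dense.
- exact: srm_plus_meet_dense.
- exact: srm_has_sup.
Qed.
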